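(* Let $S$ be a Noetherian ring, let $g_1,\dots,g_c$ be a regular sequence in $S$, and let $R=S/(g_1,\dots,g_c)$, so that the $S$-free resolution of $R$ is the Koszul complex $$\mathbb E:\quad S\xleftarrow{\partial}S^c\xleftarrow{\partial}\textstyle\bigwedge^2S^c\xleftarrow{\partial}\cdots\xleftarrow{\partial}\bigwedge^cS^c\longleftarrow0 .$$ Let $(\mathbb K,\delta)$ be an $S$-free resolution of an $R$-module $M$ and, for $1\le j\le c$, let $\tau_j$ be a homotopy for multiplication by $g_j$ on $\mathbb K$. Let $e_1,\dots,e_c$ be a basis of $S^c$ such that $\partial(e_i)=g_i$. Let $$\sigma_{s,j}:\textstyle\bigwedge^sS^c\otimes K_j\to K_{s+j}$$ be the $S$-linear maps taking $e_{i_1}\wedge\cdots\wedge e_{i_s}\otimes a$ with $i_1<\cdots<i_s$ to $\tau_{i_1}\circ\cdots\circ\tau_{i_s}(a)$. Then the $\sigma_{s,j}$ are the components of a map of complexes $\sigma:\mathbb E\otimes_S\mathbb K\to\mathbb K$ that induces the multiplication map $R\otimes M\to M$. In particular, such a map of complexes $\sigma$ may be chosen so that its components $\sigma_{c,i}:K_i\cong\bigwedge^cS^c\otimes K_i\to K_{c+i}$ are given by $\tau_1\circ\cdots\circ\tau_c$.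
   Context: Rings are commutative. A homotopy for multiplication by $g\in S$ on $(\mathbb K,\delta)$ is a family of $S$-linear maps $\tau:K_i\to K_{i+1}$ with $\delta\tau+\tau\delta=g\cdot\mathrm{id}$. For $s=0$, $\sigma_{0,j}$ is the identity of $K_j$. The differential of $\mathbb E\otimes\mathbb K$ on $E_s\otimes K_j$, $E_s=\bigwedge^sS^c$, is $\partial\otimes1+(-1)^s\,1\otimes\delta$. The statement that $\sigma$ induces the multiplication map means that the induced map $H_0(\mathbb E\otimes\mathbb K)=R\otimes_SM\to H_0(\mathbb K)=M$ is $r\otimes m\mapsto rm$. The identification $\bigwedge^cS^c\cong S$ is the one sending $e_1\wedge\cdots\wedge e_c$ to $1$. *)

(* Defs.v *)
From HB Require Import structures.
From mathcomp.multinomials Require Import freeg.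
From mathcomp Require Import all_boot all_fingroup all_algebra.
From mathcomp Require Import zify boolp.

Set Implicit Arguments.
Unset Strict Implicit.
Unset Printing Implicit Defensive.

Import GRing.Theory.
Local Open Scope quotient_scope.
Local Open Scope ring_scope.

(* Membership is a boolean predicate so that the quotients of ring_quotient
   apply; excluded middle (boolp) turns any submodule into one of these. *)
Record submodule (S : comNzRingType) (V : lmodType S) := Submodule {
  submod_mem : {pred V};
  submod_memP : submod_closed submod_mem }.

Section SubmoduleTheory.
Variables (S : comNzRingType) (V : lmodType S).

HB.instance Definition _ (W : submodule V) :=
  GRing.isZmodClosed.Build V (submod_mem W) (GRing.submod_closedB (submod_memP W)).

Lemma submodZ (W : submodule V) a x :
  x \in submod_mem W -> a *: x \in submod_mem W.
Proof.
by move=> xW; case: (submod_memP W) => W0 WD; rewrite -[_ *: _]addr0 WD.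
Qed.

Definition span_mem (P : V -> Prop) : {pred V} := fun x =>
  `[< exists n (a : 'I_n -> S) (y : 'I_n -> V),
        (forall i, P (y i)) /\ x = \sum_i a i *: y i >].

Lemma span_closed P : submod_closed (span_mem P).
Proof.
split.
  apply/asboolP; exists 0%N, (fun=> 0), (fun=> 0).
  by split; [case | rewrite big_ord0].
move=> a x y /asboolP [n [b [u [Pu ->]]]] /asboolP [m [c [v [Pv ->]]]].
apply/asboolP; exists (n + m)%N.
exists (fun k => match split k with inl i => a * b i | inr j => c j end).
exists (fun k => match split k with inl i => u i | inr j => v j end).
split; first by move=> k; case: (split k).
rewrite big_split_ord /= scaler_sumr; congr (_ + _).
  by apply: eq_bigr => i _; rewrite (unsplitK (inl i)) scalerA.
by apply: eq_bigr => i _; rewrite (unsplitK (inr i)).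
Qed.

Definition span (P : V -> Prop) : submodule V := Submodule (span_closed P).

Lemma span_sub (P : V -> Prop) x : P x -> x \in submod_mem (span P).
Proof.
move=> Px; apply/asboolP; exists 1%N, (fun=> 1), (fun=> x).
by split=> //; rewrite big_ord1 scale1r.
Qed.

End SubmoduleTheory.

Section Range.
Variables (S : comNzRingType) (U V : lmodType S) (f : {linear U -> V}).

Definition range_mem : {pred V} := fun y => `[< exists x, y = f x >].

Lemma range_closed : submod_closed range_mem.
Proof.
split; first by apply/asboolP; exists 0; rewrite raddf0.
move=> a x y /asboolP [u ->] /asboolP [v ->]; apply/asboolP.
by exists (a *: u + v); rewrite linearP.
Qed.

Definition range : submodule V := Submodule range_closed.

End Range.

Section QuotientModule.
Variables (S : comNzRingType) (V : lmodType S) (W : submodule V).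

Definition quotmod : Type := Quotient.quot (submod_mem W).
HB.instance Definition _ := GRing.Zmodule.on quotmod.

Definition qclass (x : V) : quotmod := \pi_(Quotient.quot (submod_mem W)) x.
Definition qrepr (z : quotmod) : V :=
  @generic_quotient.repr _ (Quotient.quot (submod_mem W)) z.

Lemma qreprK z : qclass (qrepr z) = z.
Proof. exact: reprK. Qed.

Lemma qclassP x y : reflect (qclass x = qclass y) (x - y \in submod_mem W).
Proof. by rewrite Quotient.idealrBE; apply: eqP. Qed.

Lemma qclassD : {morph qclass : x y / x + y}.
Proof. by move=> x y; apply: Quotient.pi_add. Qed.

Definition quotmod_scale (a : S) (z : quotmod) : quotmod :=
  qclass (a *: qrepr z).

Lemma qclass_scale a x : quotmod_scale a (qclass x) = qclass (a *: x).
Proof.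
by apply/qclassP; rewrite -scalerBr; apply/submodZ/qclassP; rewrite qreprK.
Qed.

Lemma quotmod_scaleA a b z :
  quotmod_scale a (quotmod_scale b z) = quotmod_scale (a * b) z.
Proof. by rewrite -[z]qreprK !qclass_scale scalerA. Qed.

Lemma quotmod_scale1 : left_id 1 quotmod_scale.
Proof. by move=> z; rewrite -[z]qreprK !qclass_scale scale1r. Qed.

Lemma quotmod_scaleDr : right_distributive quotmod_scale +%R.
Proof.
move=> a z w; rewrite -[z]qreprK -[w]qreprK -qclassD !qclass_scale.
by rewrite scalerDr qclassD.
Qed.

Lemma quotmod_scaleDl z : {morph quotmod_scale^~ z : a b / a + b}.
Proof.
by move=> a b; rewrite /= -[z]qreprK !qclass_scale scalerDl qclassD.
Qed.

HB.instance Definition _ := GRing.Zmodule_isLmodule.Build S quotmod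
  quotmod_scaleA quotmod_scale1 quotmod_scaleDr quotmod_scaleDl.

Lemma qclass_is_linear : linear qclass.
Proof. by move=> a x y; rewrite qclassD -qclass_scale. Qed.

HB.instance Definition _ := GRing.isLinear.Build S V quotmod _ qclass
  qclass_is_linear.

Lemma qclass_eq0 x : x \in submod_mem W -> qclass x = 0.
Proof.
by move=> xW; rewrite -[0](raddf0 qclass); apply/qclassP; rewrite subr0.
Qed.

Section Lift.
Variables (P : lmodType S) (f : {linear V -> P}).
Implicit Type fW : forall x, x \in submod_mem W -> f x = 0.

Definition qlift fW (z : quotmod) : P := f (qrepr z).

Lemma qliftE fW x : qlift fW (qclass x) = f x.
Proof.
apply/eqP; rewrite -subr_eq0 -linearB fW //.
by apply/qclassP; rewrite qreprK.
Qed.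

Lemma qlift_is_linear fW : linear (qlift fW).
Proof.
move=> a z w; rewrite -[z]qreprK -[w]qreprK -linearP !qliftE.
exact: linearP.
Qed.

HB.instance Definition _ fW := GRing.isLinear.Build S quotmod P *:%R
  (qlift fW) (qlift_is_linear fW).

End Lift.
End QuotientModule.

Arguments qclass : simpl never.
Arguments qlift : simpl never.

(* The module generated by X subject to the relations r = 0 for rel r. *)
Section Presentation.
Variables (S : comNzRingType) (X : choiceType) (rel : {freeg X / S} -> Prop).

Definition presmod : lmodType S := quotmod (span rel).
Definition pgen (x : X) : presmod := qclass (span rel) << x >>.

Section Lift.
Variables (P : lmodType S) (f : X -> P).

HB.instance Definition _ := GRing.isZmodMorphism.Build {freeg X / S} P
  (fglift f) (lift_is_additive f).

Lemma fglift_is_linear : linear (fglift f).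
Proof.
move=> a u v; rewrite raddfD /=; congr (_ + _).
have -> : a *: u = fgscale a u by [].
rewrite /fgscale raddf_sum /=.
rewrite -[in RHS](freeg_sumE u) raddf_sum /= scaler_sumr.
by apply: eq_bigr => x _; rewrite !liftU scalerA.
Qed.

HB.instance Definition _ := GRing.isLinear.Build S {freeg X / S} P *:%R
  (fglift f) fglift_is_linear.

Lemma fglift_gen x : fglift f << x >> = f x.
Proof. by rewrite liftU scale1r. Qed.

Implicit Type frel : forall r, rel r -> fglift f r = 0.

Lemma pres_kills frel r : r \in submod_mem (span rel) -> fglift f r = 0.
Proof.
move=> /asboolP [n [a [y [ry ->]]]]; rewrite linear_sum big1 // => i _.
by rewrite linearZ_LR /= frel ?scaler0.
Qed.

Definition plift frel : presmod -> P := qlift (pres_kills frel).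

HB.instance Definition _ frel := GRing.Linear.copy (plift frel)
  (qlift (pres_kills frel)).

Lemma plift_gen frel x : plift frel (pgen x) = f x.
Proof. by rewrite /plift qliftE /= fglift_gen. Qed.

End Lift.

Lemma pres_ext (P : lmodType S) (f h : {linear presmod -> P}) :
  (forall x, f (pgen x) = h (pgen x)) -> forall z, f z = h z.
Proof.
move=> fh z; rewrite -[z]qreprK -[qrepr z]freeg_sumE.
rewrite !linear_sum /=; apply: eq_bigr => x _.
have -> : << coeff x (qrepr z) *g x >> = coeff x (qrepr z) *: << x >> :> {freeg X / S}.
  apply/eqP/freeg_eqP => y; rewrite coeffZ !coeffU.
  by rewrite mul1r.
by rewrite !linearZ_LR /= -/(pgen x) fh.
Qed.

End Presentation.

Arguments pgen : simpl never.
Arguments plift : simpl never.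

Section Tensor.
Variables (S : comNzRingType) (M N : lmodType S).

(* a *: _ + _ covers additivity (a = 1) and homogeneity (x' = 0 or y' = 0). *)
Inductive tensor_rel : {freeg (M * N)%type / S} -> Prop :=
| TensorRelL a x x' y : tensor_rel
    (<< (a *: x + x', y) >> - (a *: << (x, y) >> + << (x', y) >>))
| TensorRelR a x y y' : tensor_rel
    (<< (x, a *: y + y') >> - (a *: << (x, y) >> + << (x, y') >>)).

Definition tensor : lmodType S := presmod tensor_rel.
Definition tens (x : M) (y : N) : tensor := pgen tensor_rel (x, y).

Lemma tensPl a x x' y : tens (a *: x + x') y = a *: tens x y + tens x' y.
Proof.
apply/eqP; rewrite -subr_eq0; apply/eqP.
rewrite /tens /pgen -linearP -linearB; apply: qclass_eq0; apply: span_sub.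
exact: TensorRelL.
Qed.

Lemma tensPr a x y y' : tens x (a *: y + y') = a *: tens x y + tens x y'.
Proof.
apply/eqP; rewrite -subr_eq0; apply/eqP.
rewrite /tens /pgen -linearP -linearB; apply: qclass_eq0; apply: span_sub.
exact: TensorRelR.
Qed.

Lemma tens0l y : tens 0 y = 0.
Proof.
apply: (addrI (tens 0 y)); have := tensPl 1 0 0 y.
by rewrite scaler0 !addr0 scale1r.
Qed.

Lemma tens0r x : tens x 0 = 0.
Proof.
apply: (addrI (tens x 0)); have := tensPr 1 x 0 0.
by rewrite scaler0 !addr0 scale1r.
Qed.

Section Lift.
Variables (P : lmodType S) (f : M -> N -> P).
Implicit Types (fl : forall y, linear (f^~ y)) (fr : forall x, linear (f x)).

Lemma tensor_kills fl fr r : tensor_rel r -> fglift (fun p => f p.1 p.2) r = 0.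
Proof.
case=> *; rewrite linearB linearP /= !fglift_gen /=.
  by rewrite fl subrr.
by rewrite fr subrr.
Qed.

Definition tlift fl fr : tensor -> P := plift (tensor_kills fl fr).

HB.instance Definition _ fl fr := GRing.Linear.copy (tlift fl fr)
  (plift (tensor_kills fl fr)).

Lemma tlift_tens fl fr x y : tlift fl fr (tens x y) = f x y.
Proof. exact: plift_gen. Qed.

End Lift.

Lemma tensor_ext (P : lmodType S) (f h : {linear tensor -> P}) :
  (forall x y, f (tens x y) = h (tens x y)) -> forall z, f z = h z.
Proof. by move=> fh; apply: pres_ext => -[x y]; apply: fh. Qed.

End Tensor.

Arguments tens : simpl never.
Arguments tlift : simpl never.

Section TensorMap.
Variables (S : comNzRingType) (M M' N N' : lmodType S).
Variables (f : {linear M -> M'}) (h : {linear N -> N'}).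

Lemma tmap_linl y : linear (fun x => tens (f x) (h y)).
Proof. by move=> a x x'; rewrite linearP tensPl. Qed.

Lemma tmap_linr x : linear (fun y => tens (f x) (h y)).
Proof. by move=> a y y'; rewrite linearP tensPr. Qed.

Definition tmap : tensor M N -> tensor M' N' := tlift tmap_linl tmap_linr.

HB.instance Definition _ := GRing.Linear.copy tmap (tlift tmap_linl tmap_linr).

Lemma tmap_tens x y : tmap (tens x y) = tens (f x) (h y).
Proof. exact: tlift_tens. Qed.

Lemma tmapP a z w : tmap (a *: z + w) = a *: tmap z + tmap w.
Proof. exact: linearP. Qed.

Lemma tmapD z w : tmap (z + w) = tmap z + tmap w.
Proof. exact: raddfD. Qed.

Lemma tmapZ a z : tmap (a *: z) = a *: tmap z.
Proof. exact: linearZ. Qed.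

End TensorMap.

Lemma tmap_comp (S : comNzRingType) (M M' M'' N N' N'' : lmodType S)
    (f : {linear M -> M'}) (f' : {linear M' -> M''})
    (h : {linear N -> N'}) (h' : {linear N' -> N''}) z :
  tmap f' h' (tmap f h z) = tmap (f' \o f) (h' \o h) z.
Proof.
pose F : {linear tensor M N -> tensor M'' N''} := tmap f' h' \o tmap f h.
apply: (tensor_ext (f := F)) => x y.
by rewrite /= !tmap_tens.
Qed.

Lemma tmap_eq (S : comNzRingType) (M M' N N' : lmodType S)
    (f f' : {linear M -> M'}) (h h' : {linear N -> N'}) z :
  f =1 f' -> h =1 h' -> tmap f h z = tmap f' h' z.
Proof.
by move=> ff hh; apply: tensor_ext => x y; rewrite /= !tmap_tens ff hh.
Qed.

Lemma tmap0l (S : comNzRingType) (M M' N N' : lmodType S)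
    (f : {linear M -> M'}) (h : {linear N -> N'}) z :
  (forall x, f x = 0) -> tmap f h z = 0.
Proof.
move=> f0; pose o : {linear tensor M N -> tensor M' N'} := \0.
by apply: (tensor_ext (h := o)) => x y; rewrite /= tmap_tens f0 tens0l.
Qed.

Lemma tmap0r (S : comNzRingType) (M M' N N' : lmodType S)
    (f : {linear M -> M'}) (h : {linear N -> N'}) z :
  (forall y, h y = 0) -> tmap f h z = 0.
Proof.
move=> h0; pose o : {linear tensor M N -> tensor M' N'} := \0.
by apply: (tensor_ext (h := o)) => x y; rewrite /= tmap_tens h0 tens0r.
Qed.

Arguments tmap : simpl never.

Section Exterior.
Variables (S : comNzRingType) (V : lmodType S) (s : nat).

Definition upd (v : 'I_s -> V) (i : 'I_s) (x : V) : 'I_s -> V :=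
  fun k => if k == i then x else v k.

Definition multilinear (P : lmodType S) (f : ('I_s -> V) -> P) : Prop :=
  forall v i a x y, f (upd v i (a *: x + y)) = a *: f (upd v i x) + f (upd v i y).

Definition alternating (P : lmodType S) (f : ('I_s -> V) -> P) : Prop :=
  forall v (i j : 'I_s), i != j -> v i = v j -> f v = 0.

(* The exterior power is V^{(x) s} modulo the tensors with two equal entries,
   presented directly by the s-fold symbols v_0 /\ ... /\ v_(s-1). *)
Inductive ext_rel : {freeg {ffun 'I_s -> V} / S} -> Prop :=
| ExtRelLin v i a x y : ext_rel
    (<< finfun (upd v i (a *: x + y)) >>
     - (a *: << finfun (upd v i x) >> + << finfun (upd v i y) >>))
| ExtRelAlt (v : 'I_s -> V) i j : i != j -> v i = v j -> ext_rel << finfun v >>.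

Definition ext_power : lmodType S := presmod ext_rel.
Definition wedge (v : 'I_s -> V) : ext_power := pgen ext_rel (finfun v).

Lemma wedge_lin : multilinear wedge.
Proof.
move=> v i a x y; apply/eqP; rewrite -subr_eq0; apply/eqP.
rewrite /wedge /pgen -linearP -linearB; apply: qclass_eq0; apply: span_sub.
exact: ExtRelLin.
Qed.

Lemma wedge_alt : alternating wedge.
Proof.
move=> v i j ij vij; apply: qclass_eq0; apply: span_sub.
exact: (ExtRelAlt ij vij).
Qed.

Section Lift.
Variables (P : lmodType S) (f : ('I_s -> V) -> P).
Implicit Types (fl : multilinear f) (fa : alternating f).

Lemma ext_kills fl fa r :
  ext_rel r -> fglift (fun v : {ffun 'I_s -> V} => f v) r = 0.
Proof.
have fE v : f (finfun v) = f v by congr f; apply/funext => k; rewrite ffunE.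
case=> [v i a x y | v i j ij vij].
  by rewrite linearB linearP /= !fglift_gen !fE fl subrr.
by rewrite /= fglift_gen fE (fa _ _ _ ij vij).
Qed.

Definition elift fl fa : ext_power -> P := plift (ext_kills fl fa).

HB.instance Definition _ fl fa := GRing.Linear.copy (elift fl fa)
  (plift (ext_kills fl fa)).

Lemma elift_wedge fl fa v : elift fl fa (wedge v) = f v.
Proof.
by rewrite /elift plift_gen; congr f; apply/funext => k; rewrite ffunE.
Qed.

End Lift.

Lemma ext_ext (P : lmodType S) (f h : {linear ext_power -> P}) :
  (forall v, f (wedge v) = h (wedge v)) -> forall z, f z = h z.
Proof.
move=> fh; apply: pres_ext => v.
have <- : finfun v = v by apply/ffunP => k; rewrite ffunE.
exact: fh.
Qed.

Lemma upd_id v i : upd v i (v i) = v.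
Proof. by apply/funext => k; rewrite /upd; case: eqP => [->|]. Qed.

Lemma wedgeD v i x y : wedge (upd v i (x + y)) = wedge (upd v i x) + wedge (upd v i y).
Proof. by rewrite -[x in LHS]scale1r wedge_lin scale1r. Qed.

Lemma wedge_tperm v i j : i != j -> wedge (v \o tperm i j) = - wedge v.
Proof.
move=> ij; apply/eqP; rewrite -addr_eq0; apply/eqP.
pose w x y := wedge (upd (upd v i x) j y).
have wC x y : w x y = wedge (upd (upd v j y) i x).
  congr wedge; apply/funext => k; rewrite /upd.
  by case: (k =P j) => [->|//]; rewrite eq_sym (negPf ij).
have w0 x : w x x = 0.
  by apply: (wedge_alt ij); rewrite /upd eqxx (negPf ij) eqxx.
have wDl x x' y : w (x + x') y = w x y + w x' y by rewrite !wC wedgeD.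
have wDr x y y' : w x (y + y') = w x y + w x y' by rewrite /w wedgeD.
have -> : wedge v = w (v i) (v j) by rewrite /w upd_id upd_id.
have -> : wedge (v \o tperm i j) = w (v j) (v i).
  congr wedge; apply/funext => k; rewrite /upd /=.
  case: tpermP => [->|->|/eqP/negPf-> /eqP/negPf-> //].
    by rewrite (negPf ij) eqxx.
  by rewrite eqxx.
have := w0 (v i + v j).
by rewrite wDl !wDr !w0 add0r addr0 addrC.
Qed.

Lemma wedge_perm v (p : 'S_s) : wedge (v \o p) = (-1) ^+ p *: wedge v.
Proof.
have [ts -> dts] := prod_tpermP p.
elim: ts dts v => [|[i j] ts IH] /= dts v.
  rewrite big_nil odd_perm1 scale1r; congr wedge.
  by apply/funext => k /=; rewrite perm1.
case/andP: dts => ij dts; rewrite big_cons odd_permM odd_tperm.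
have -> : v \o (tperm i j * \prod_(t <- ts) tperm t.1 t.2)%g
        = (v \o (\prod_(t <- ts) tperm t.1 t.2)%g) \o tperm i j.
  by apply/funext => k /=; rewrite permM.
by rewrite wedge_tperm // IH // ij signr_addb expr1 mulN1r scaleNr.
Qed.

End Exterior.

Arguments wedge : simpl never.
Arguments elift : simpl never.

Section Koszul.
Variables (S : comNzRingType) (V : lmodType S) (phi : {linear V -> S^o}).

(* d (v_0 /\ ... /\ v_s) = sum_k (-1)^k phi(v_k) v_0 /\ .. (omit v_k) .. /\ v_s;
   v \o lift k is the family v with its k-th entry omitted. *)
Definition kos_sum s (v : 'I_s.+1 -> V) : ext_power V s :=
  \sum_(k < s.+1) (-1) ^+ k *: (phi (v k) *: wedge (v \o lift k)).

Lemma kos_sum_lin s : multilinear (@kos_sum s).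
Proof.
move=> v i a x y; rewrite /kos_sum scaler_sumr -big_split /=.
apply: eq_bigr => k _; rewrite [a *: (_ *: _)]scalerA (mulrC a) -scalerA -scalerDr.
congr (_ *: _); have [->|ki] := eqVneq k i.
  have E z : upd v i z \o lift i = v \o lift i.
    by apply/funext => m; rewrite /upd /= eq_sym (negPf (neq_lift _ _)).
  by rewrite !E /upd eqxx linearP scalerDl scalerA.
have [m im] : {m | i = lift k m}.
  by case: (unlift_some ki) => m im _; exists m.
have E z : upd v i z \o lift k = upd (v \o lift k) m z.
  by apply/funext => l; rewrite /upd /= im (inj_eq lift_inj).
by rewrite !E wedge_lin scalerDr /upd (negPf ki) !scalerA mulrC.
Qed.

Lemma kos_sum_alt s : alternating (@kos_sum s).
Proof.
move=> v i j ij vij; rewrite /kos_sum (bigD1 i) //= (bigD1 j) 1?eq_sym //=.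
rewrite [X in _ + (_ + X)]big1 ?addr0; last first.
  move=> k /andP [ki kj].
  case: (unlift_some ki) => m im _; case: (unlift_some kj) => l jl _.
  have ml : m != l by apply: contra_neq ij => ml; rewrite im jl ml.
  by rewrite (wedge_alt ml) ?scaler0 //= -im -jl.
pose q l := odflt l (unlift i (tperm i j (lift j l))).
have qE l : lift i (q l) = tperm i j (lift j l).
  have ne : i != tperm i j (lift j l).
    rewrite -{1}[i](tpermR i j) (inj_eq perm_inj).
    exact: neq_lift.
  by rewrite /q; case: (unlift_some ne) => m -> ->.
have qinj : injective q.
  move=> l m qlm; apply: (@lift_inj _ j); apply: (@perm_inj _ (tperm i j)).
  by rewrite -!qE qlm.
pose p := perm qinj.
have tE : tperm i j = lift_perm j i p.
  apply/permP => k; case: (unliftP j k) => [l ->|->].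
    by rewrite lift_perm_lift [p l]permE qE.
  by rewrite lift_perm_id tpermR.
have -> : v \o lift j = (v \o lift i) \o p.
  apply/funext => l /=; rewrite [p l]permE qE.
  by case: tpermP => [->|ji|//]; [rewrite vij | case/eqP: (neq_lift j l)].
rewrite wedge_perm vij !scalerA -mulrA [_ * (-1) ^+ p]mulrC mulrA -signr_odd.
rewrite -[(-1) ^+ j]signr_odd -signr_addb.
have oE := odd_tperm i j; rewrite tE odd_lift_perm ij in oE.
have -> : (odd j (+) p) = ~~ odd i.
  by move: oE; case: (odd i); case: (odd j); case: (odd_perm p).
by rewrite signrN mulNr scaleNr subrr.
Qed.

Definition kos_d s : ext_power V s.+1 -> ext_power V s :=
  elift (@kos_sum_lin s) (@kos_sum_alt s).

HB.instance Definition _ s := GRing.Linear.copy (@kos_d s)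
  (elift (@kos_sum_lin s) (@kos_sum_alt s)).

Lemma kos_d_wedge s v : kos_d (wedge v) =
  \sum_(k < s.+1) (-1) ^+ k *: (phi (v k) *: wedge (v \o lift k)).
Proof. exact: elift_wedge. Qed.

End Koszul.

Arguments kos_d {S V} phi {s} : simpl never.

Section KoszulSquare.
Variables (S : comNzRingType) (V : lmodType S) (phi : {linear V -> S^o}).
Variable s : nat.

(* The involution (omit k, then l) <-> (omit the same two entries in the other
   order), which exchanges l < k and k <= l. *)
Definition kos_flip (p : 'I_s.+2 * 'I_s.+1) : 'I_s.+2 * 'I_s.+1 :=
  (lift p.1 p.2, inord (unbump p.2 p.1)).

Lemma kos_flip_val p : (kos_flip p).2 = unbump p.2 p.1 :> nat.
Proof.
case: p => k l; rewrite /= inordK // /unbump.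
have := ltn_ord k; have := ltn_ord l; case: (ltnP l k) => /=; lia.
Qed.

Lemma kos_flipK : involutive kos_flip.
Proof.
move=> p; have E := kos_flip_val p.
have F := kos_flip_val (kos_flip p).
have G : (kos_flip (kos_flip p)).1 = p.1 :> nat.
  by rewrite /= /bump E /= /bump /unbump; do 2!case: leqP => //=; lia.
have H : (kos_flip (kos_flip p)).2 = p.2 :> nat.
  by rewrite F E /= /bump /unbump; do 2!case: leqP => //=; lia.
by rewrite [LHS]surjective_pairing [RHS]surjective_pairing; congr pair; apply: val_inj.
Qed.

Lemma kos_flip_lt p : ((kos_flip p).2 < (kos_flip p).1)%N = ~~ (p.2 < p.1)%N.
Proof. by rewrite kos_flip_val /= /bump /unbump; case: leqP => //=; lia. Qed.

Lemma kos_flip_lift p m :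
  lift (kos_flip p).1 (lift (kos_flip p).2 m) = lift p.1 (lift p.2 m).
Proof.
by apply: val_inj; rewrite /= kos_flip_val -bumpC.
Qed.

Lemma kos_dd (z : ext_power V s.+2) : kos_d phi (kos_d phi z) = 0.
Proof.
pose f : {linear ext_power V s.+2 -> ext_power V s} := kos_d phi \o @kos_d _ _ phi s.+1.
suff f0 : forall v, f (wedge v) = (\0 : {linear ext_power V s.+2 -> ext_power V s}) (wedge v).
  exact: (ext_ext f0 z).
move=> v; rewrite /= kos_d_wedge linear_sum.
pose F (p : 'I_s.+2 * 'I_s.+1) : ext_power V s :=
  ((-1) ^+ (p.1 + p.2) * (phi (v p.1) * phi (v (lift p.1 p.2))))
    *: wedge (fun m => v (lift p.1 (lift p.2 m))).
transitivity (\sum_p F p).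
  rewrite -(pair_bigA _ (fun k l => F (k, l))) /=.
  apply: eq_bigr => k _.
  rewrite 2!linearZ_LR /= kos_d_wedge !scaler_sumr.
  apply: eq_bigr => l _; rewrite /F /= !scalerA exprD; congr (_ *: _).
  by rewrite -!mulrA; congr (_ * _); rewrite mulrCA.
rewrite (bigID (fun p : 'I_s.+2 * 'I_s.+1 => (p.2 < p.1)%N)) /=.
rewrite [X in _ + X](reindex_onto kos_flip kos_flip) => [|p _]; last first.
  exact: kos_flipK.
rewrite [X in _ + X](eq_bigl (fun p : 'I_s.+2 * 'I_s.+1 => (p.2 < p.1)%N)); last first.
  by move=> p; rewrite kos_flip_lt kos_flipK eqxx andbT negbK.
rewrite -big_split big1 //= => p lp; rewrite /F.
have -> : (fun m => v (lift (kos_flip p).1 (lift (kos_flip p).2 m)))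
        = (fun m => v (lift p.1 (lift p.2 m))).
  by apply/funext => m; rewrite kos_flip_lift.
have -> : lift (kos_flip p).1 (kos_flip p).2 = p.1.
  by have := congr1 fst (kos_flipK p).
rewrite /= -scalerDl [phi (v (lift _ _)) * _]mulrC -mulrDl.
have -> : (-1) ^+ (lift p.1 p.2 + (inord (unbump p.2 p.1) : 'I_s.+1))
        = - (-1) ^+ (p.1 + p.2) :> S.
  have E := kos_flip_val p; rewrite /= in E; rewrite E /= /bump /unbump lp.
  rewrite leqNgt lp /= add0n addnC -[in RHS](@subnK 1 p.1); last by lia.
  by rewrite addn1 addSn exprS mulN1r opprK.
by rewrite subrr mul0r scale0r.
Qed.

End KoszulSquare.

(* Complexes concentrated in degrees n >= 0; cdiff n : C_(n+1) -> C_n, and C_(-1)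
   is zero. *)
Record complex (S : comNzRingType) := Complex {
  cobj :> nat -> lmodType S;
  cdiff : forall n, {linear cobj n.+1 -> cobj n};
  cdiffK : forall n x, cdiff n (cdiff n.+1 x) = 0 }.

Definition koszul (S : comNzRingType) (V : lmodType S) (phi : {linear V -> S^o}) :
  complex S := Complex (@kos_dd S V phi).

Record chain_map (S : comNzRingType) (C D : complex S) := ChainMap {
  cmap :> forall n, {linear C n -> D n};
  cmapC : forall n x, cmap n (cdiff C n x) = cdiff D n (cmap n.+1 x) }.

Section DirectProduct.
Variables (S : comNzRingType) (I : Type) (T : I -> lmodType S).

Definition dprod : Type := forall i, T i.

HB.instance Definition _ := gen_eqMixin dprod.
HB.instance Definition _ := gen_choiceMixin dprod.

Let add (x y : dprod) : dprod := fun i => x i + y i.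
Let opp (x : dprod) : dprod := fun i => - x i.
Let zero : dprod := fun=> 0.
Let scale a (x : dprod) : dprod := fun i => a *: x i.

Let addA : associative add.
Proof. by move=> x y z; apply: functional_extensionality_dep => i; apply: addrA. Qed.
Let addC : commutative add.
Proof. by move=> x y; apply: functional_extensionality_dep => i; apply: addrC. Qed.
Let add0 : left_id zero add.
Proof. by move=> x; apply: functional_extensionality_dep => i; apply: add0r. Qed.
Let addN : left_inverse zero opp add.
Proof. by move=> x; apply: functional_extensionality_dep => i; apply: addNr. Qed.

HB.instance Definition _ := GRing.isZmodule.Build dprod addA addC add0 addN.

Let scaleA a b x : scale a (scale b x) = scale (a * b) x.
Proof. by apply: functional_extensionality_dep => i; apply: scalerA. Qed.
Let scale1 : left_id 1 scale.
Proof. by move=> x; apply: functional_extensionality_dep => i; apply: scale1r. Qed.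
Let scaleDr : right_distributive scale +%R.
Proof. by move=> a x y; apply: functional_extensionality_dep => i; apply: scalerDr. Qed.
Let scaleDl x : {morph scale^~ x : a b / a + b}.
Proof. by move=> a b; apply: functional_extensionality_dep => i; apply: scalerDl. Qed.

HB.instance Definition _ := GRing.Zmodule_isLmodule.Build S dprod
  scaleA scale1 scaleDr scaleDl.

Lemma dprod_scaleDE a (x y : dprod) i : (a *: x + y) i = a *: x i + y i.
Proof. by []. Qed.

End DirectProduct.

Section TensorComplex.
Variables (S : comNzRingType) (C D : complex S).

(* (C (x) D)_n is the product of the C_s (x) D_j over s + j = n; there are finitely
   many such pairs, so this is the direct sum. *)
Definition bideg n := {p : nat * nat | p.1 + p.2 == n}%N.

Definition tot_term n (p : bideg n) : lmodType S :=
  tensor (C (val p).1) (D (val p).2).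

Definition tot n : lmodType S := dprod (@tot_term n).

Definition bidegl n (p : bideg n) : bideg n.+1 :=
  exist _ ((val p).1.+1, (val p).2) (valP p).

Definition bidegr n (p : bideg n) : bideg n.+1.
Proof.
exists ((val p).1, (val p).2.+1); rewrite /= addnS eqSS; exact: valP p.
Defined.

(* The (s, j) component of d x receives d (x) 1 from (s+1, j) and
   (-1)^s 1 (x) d from (s, j+1). *)
Definition tot_d n (x : tot n.+1) : tot n := fun p =>
  tmap (cdiff C (val p).1) idfun (x (bidegl p))
  + (-1) ^+ (val p).1 *: tmap idfun (cdiff D (val p).2) (x (bidegr p)).

Lemma tot_d_linear n : linear (@tot_d n).
Proof.
move=> a x y; apply: functional_extensionality_dep => p.
rewrite dprod_scaleDE /tot_d 2!dprod_scaleDE 2!tmapP 2!scalerDr addrACA.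
by congr (_ + _ + _); rewrite !scalerA mulrC.
Qed.

HB.instance Definition _ n := GRing.isLinear.Build S (tot n.+1) (tot n) *:%R
  (@tot_d n) (@tot_d_linear n).

Lemma tot_irr n (x : tot n) s j e e' :
  x (exist _ (s, j) e) = x (exist _ (s, j) e') :> tensor (C s) (D j).
Proof. by rewrite (eq_irrelevance e e'). Qed.

Lemma tot_dK n (x : tot n.+2) : tot_d (tot_d x) = 0.
Proof.
apply: functional_extensionality_dep => -[[s j] e].
rewrite /tot_d /= 2!tmapD 2!tmapZ 4!tmap_comp.
rewrite tmap0l; last exact: cdiffK.
rewrite [X in _ + _ *: (_ + _ *: X)]tmap0r; last exact: cdiffK.
rewrite scaler0 addr0 add0r exprS mulN1r scaleNr.
rewrite [X in _ + _ *: X](tmap_eq (f' := cdiff C s \o idfun)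
  (h' := idfun \o cdiff D j)) //.
apply/eqP; rewrite addrC subr_eq0; apply/eqP.
by congr (_ *: tmap _ _ _); apply: tot_irr.
Qed.

Definition tensor_complex : complex S := Complex tot_dK.

Definition bideg_of s j : bideg (s + j) := exist _ (s, j) (eqxx (s + j)%N).

Definition tot_in s j (z : tensor (C s) (D j)) : tot (s + j) :=
  @dfwith _ (fun p : bideg (s + j) => tot_term p : Type) (fun=> 0)
    (bideg_of s j) z.

End TensorComplex.

Section ZerothHomology.
Variable S : comNzRingType.

Definition homology0 (C : complex S) : lmodType S :=
  quotmod (range (cdiff C 0)).

Definition hclass0 (C : complex S) (x : C 0) : homology0 C :=
  qclass (range (cdiff C 0)) x.

HB.instance Definition _ C := GRing.Linear.copy (@hclass0 C)
  (qclass (range (cdiff C 0))).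

Variables (C D : complex S) (f : chain_map C D).

Lemma homology0_map_kills x :
  x \in submod_mem (range (cdiff C 0)) ->
  (qclass (range (cdiff D 0)) \o f 0) x = 0.
Proof.
move=> /asboolP [y ->] /=; rewrite cmapC; apply: qclass_eq0.
by apply/asboolP; exists (f 1 y).
Qed.

Definition homology0_map : homology0 C -> homology0 D :=
  qlift homology0_map_kills.

HB.instance Definition _ := GRing.Linear.copy homology0_map
  (qlift homology0_map_kills).

Lemma homology0_map_class x : homology0_map (hclass0 x) = hclass0 (f 0 x).
Proof. exact: qliftE. Qed.

End ZerothHomology.

Arguments homology0_map {S C D} f : simpl never.

(* f is a phantom argument: it determines the S-module structure below. *)
Definition restrict (S R : comNzRingType) (f : {rmorphism S -> R})
  (M : lmodType R) : Type := M.

Section RestrictionOfScalars.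
Variables (S R : comNzRingType) (f : {rmorphism S -> R}) (M : lmodType R).
Local Notation restrict := (restrict f M).

HB.instance Definition _ := GRing.Zmodule.on restrict.

Let scale (a : S) (x : restrict) : restrict := f a *: (x : M).

Let scaleA a b x : scale a (scale b x) = scale (a * b) x.
Proof. by rewrite /scale rmorphM scalerA. Qed.
Let scale1 : left_id 1 scale.
Proof. by move=> x; rewrite /scale rmorph1 scale1r. Qed.
Let scaleDr : right_distributive scale +%R.
Proof. by move=> a x y; apply: scalerDr. Qed.
Let scaleDl x : {morph scale^~ x : a b / a + b}.
Proof. by move=> a b; rewrite /scale rmorphD scalerDl. Qed.

HB.instance Definition _ := GRing.Zmodule_isLmodule.Build S restrict
  scaleA scale1 scaleDr scaleDl.

Lemma restrict_scaleE a (x : restrict) : a *: x = f a *: (x : M) :> M.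
Proof. by []. Qed.

End RestrictionOfScalars.

Section Multiplication.
Variables (S R : comNzRingType) (f : {rmorphism S -> R}) (M : lmodType R).

Let act (r : restrict f R^o) (m : restrict f M) : restrict f M :=
  (r : R) *: (m : M).

Lemma mul_map_linl m : linear (act^~ m).
Proof. by move=> a r r'; rewrite /act restrict_scaleE scalerDl -scalerA. Qed.

Lemma mul_map_linr r : linear (act r).
Proof.
move=> a m m'; rewrite /act !restrict_scaleE scalerDr !scalerA.
by rewrite [r * _]mulrC.
Qed.

Definition mul_map : tensor (restrict f R^o) (restrict f M) -> restrict f M :=
  tlift mul_map_linl mul_map_linr.

HB.instance Definition _ := GRing.Linear.copy mul_map
  (tlift mul_map_linl mul_map_linr).

Lemma mul_map_tens (r : R) (m : M) :
  mul_map (tens (r : restrict f R^o) (m : restrict f M)) = r *: m :> M.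
Proof. by rewrite /mul_map tlift_tens. Qed.

End Multiplication.

Arguments mul_map {S R} f M : simpl never.

Definition is_basis (S : comNzRingType) (V : lmodType S) (I : eqType)
    (b : I -> V) : Prop :=
  (forall v, exists (s : seq I) (a : I -> S), v = \sum_(i <- s) a i *: b i) /\
  (forall (s : seq I) (a : I -> S), uniq s ->
     \sum_(i <- s) a i *: b i = 0 -> forall i, i \in s -> a i = 0).

(* Freeness on a possibly infinite basis. *)
Definition free_module (S : comNzRingType) (V : lmodType S) : Prop :=
  exists (I : eqType) (b : I -> V), is_basis b.

Definition free_resolution (S : comNzRingType) (K : complex S) (M : lmodType S)
    (eps : {linear K 0 -> M}) : Prop :=
  [/\ forall n, free_module (K n),
      forall n x, cdiff K n x = 0 -> exists y, x = cdiff K n.+1 y,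
      forall x, eps x = 0 <-> exists y, x = cdiff K 0 y
    & forall m, exists x, eps x = m].

(* In degree 0 the term tau d vanishes, since K_(-1) = 0. *)
Definition homotopy_for (S : comNzRingType) (K : complex S) (g : S)
    (tau : forall n, {linear K n -> K n.+1}) : Prop :=
  (forall x, cdiff K 0 (tau 0 x) = g *: x) /\
  (forall n x, cdiff K n.+1 (tau n.+1 x) + tau n (cdiff K n x) = g *: x).

(* tau_(i 0) o ... o tau_(i (s-1)); s.+1 + j and (s + j).+1 are convertible. *)
Fixpoint iter_tau (S : comNzRingType) (K : nat -> lmodType S) (I : Type)
    (tau : I -> forall n, {linear K n -> K n.+1}) (s j : nat) :
    ('I_s -> I) -> K j -> K (s + j)%N :=
  if s is s'.+1 then
    fun i a => tau (i ord0) (s' + j)%N (iter_tau tau (fun k => i (lift ord0 k)) a)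
  else fun _ a => a.

Section Rings.
Variable S : comNzRingType.

Definition is_ideal (I : S -> Prop) : Prop :=
  I 0 /\ forall a x y, I x -> I y -> I (a * x + y).

Definition in_ideal n (g : 'I_n -> S) (x : S) : Prop :=
  exists a : 'I_n -> S, x = \sum_i a i * g i.

Definition noetherian : Prop := forall I, is_ideal I ->
  exists n (g : 'I_n -> S), forall x, I x <-> in_ideal g x.

(* The ideal generated by the first k terms of g. *)
Definition in_prefix_ideal c (g : 'I_c -> S) (k : nat) (x : S) : Prop :=
  exists a : 'I_c -> S, x = \sum_(i < c | (i < k)%N) a i * g i.

(* g_i is a nonzerodivisor modulo (g_0, ..., g_(i-1)), and (g) <> S. *)
Definition regular_sequence c (g : 'I_c -> S) : Prop :=
  ~ in_ideal g 1 /\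
  forall (i : 'I_c) x, in_prefix_ideal g i (g i * x) -> in_prefix_ideal g i x.

Section QuotientRing.
Variables (c : nat) (g : 'I_c -> S).

(* gP is used only to make the ideal proper, as comNzRingType quotients
   require. *)
Definition seq_ideal (gP : regular_sequence g) : {pred S} :=
  fun x => `[< in_ideal g x >].

Lemma seq_ideal_closed gP : idealr_closed (seq_ideal gP).
Proof.
split.
- by apply/asboolP; exists (fun=> 0); rewrite big1 // => i _; rewrite mul0r.
- by apply/asboolP; case: gP.
- move=> a x y /asboolP [u ->] /asboolP [v ->]; apply/asboolP.
  exists (fun i => a * u i + v i); rewrite mulr_sumr -big_split /=.
  by apply: eq_bigr => i _; rewrite mulrDl mulrA.
Qed.

HB.instance Definition _ gP := isIdealr.Build S (seq_ideal gP)
  (seq_ideal_closed gP).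

Definition seq_quotient gP : comNzRingType := {ideal_quot (seq_ideal gP)}.

Definition seq_proj gP : {rmorphism S -> seq_quotient gP} :=
  \pi_{ideal_quot (seq_ideal gP)}.

End QuotientRing.
End Rings.

(* The first Koszul differential S^c -> S. *)
Definition lin_form (S : comNzRingType) c (g : 'I_c -> S) (x : 'rV[S]_c) : S^o :=
  \sum_i x 0 i * g i.

Lemma lin_form_linear (S : comNzRingType) c (g : 'I_c -> S) : linear (lin_form g).
Proof.
move=> a x y; rewrite /lin_form scaler_sumr -big_split /=.
by apply: eq_bigr => i _; rewrite !mxE mulrDl -[RHS]/(a * _ + _) mulrA.
Qed.

HB.instance Definition _ (S : comNzRingType) c (g : 'I_c -> S) :=
  GRing.isLinear.Build S 'rV[S]_c S^o *:%R (lin_form g) (lin_form_linear g).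

Definition koszul_seq (S : comNzRingType) c (g : 'I_c -> S) : complex S :=
  koszul (lin_form g).

(* The identification of the 0-th exterior power with S. *)
Section ExteriorZero.
Variables (S : comNzRingType) (V : lmodType S).

Let one (v : 'I_0 -> V) : S^o := 1.

Lemma ext0_lin : multilinear one. Proof. by move=> v []. Qed.
Lemma ext0_alt : alternating one. Proof. by move=> v []. Qed.

Definition ext0 : ext_power V 0 -> S^o := elift ext0_lin ext0_alt.

HB.instance Definition _ := GRing.Linear.copy ext0 (elift ext0_lin ext0_alt).

Lemma ext0_wedge v : ext0 (wedge v) = 1.
Proof. by rewrite /ext0 elift_wedge. Qed.

End ExteriorZero.

Arguments ext0 {S V} : simpl never.

(* theta is the identification H_0(E (x) K) = R (x) M and psi is H_0(K) = M; each is
   determined by its values on classes. *)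
Definition induces_multiplication (S R : comNzRingType)
    (pi : {rmorphism S -> R}) (c : nat) (g : 'I_c -> S) (K : complex S)
    (M : lmodType R) (eps : {linear K 0 -> restrict pi M})
    (sigma : chain_map (tensor_complex (koszul_seq g) K) K) : Prop :=
  exists (theta : {linear homology0 (tensor_complex (koszul_seq g) K) ->
                          tensor (restrict pi R^o) (restrict pi M)})
         (psi : {linear homology0 K -> restrict pi M}),
    [/\ bijective theta /\ bijective psi,
        forall (x : koszul_seq g 0) (a : K 0),
          theta (hclass0 (C := tensor_complex _ _)
                   (tot_in (C := koszul_seq g) (D := K) (tens x a)))
          = tens (pi (ext0 x) : restrict pi R^o) (eps a),
        forall a : K 0, psi (hclass0 a) = eps a
      & forall z, psi (homology0_map sigma z) = mul_map pi M (theta z)].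

(* The indices i_1 < ... < i_s are a strictly increasing i : 'I_s -> 'I_c. *)
Definition sigma_spec (S : comNzRingType) (c : nat) (g : 'I_c -> S)
    (e : 'I_c -> 'rV[S]_c) (K : complex S)
    (tau : 'I_c -> forall n, {linear K n -> K n.+1})
    (sigma : forall s j, {linear tensor (koszul_seq g s) (K j) -> K (s + j)%N})
    : Prop :=
  forall s j (i : 'I_s -> 'I_c), {homo i : k l / (k < l)%N} ->
  forall a : K j, sigma s j (tens (wedge (e \o i)) a) = iter_tau tau i a.

(* Main.v *)
Require Import Defs.
From HB Require Import structures.
From mathcomp Require Import all_boot all_algebra fingroup perm boolp.

Set Implicit Arguments.
Unset Strict Implicit.
Unset Printing Implicit Defensive.

Import GRing.Theory.
Local Open Scope ring_scope.

(** Write T_i for the homotopy tau_i and D for the differential of K. On a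
    composite T_(i_0) ... T_(i_s) the relation D T_i = g_i - T_i D, applied once
    per factor, gives
      D T_(i_0) ... T_(i_s) = sum_k (-1)^k g_(i_k) T_(i_0) .. (omit k) .. T_(i_s)
                              + (-1)^(s+1) T_(i_0) ... T_(i_s) D
    ([tot_diff_iter]). The sum is the image under sigma of the Koszul differential
    of e_(i_0) /\ ... /\ e_(i_s), and the last term is that of the differential of
    K, so sigma commutes with the differentials on the elements e_I (x) a with I
    increasing. The T_i need not commute: omitting an index leaves an increasing
    family, so only composites in increasing order occur. These elements generate
    ([tensor_eq_increasing]), which gives both the uniqueness of sigma and the
    compatibility with differentials ([tot_diff_sigma]).

    For sigma to exist, the increasing wedges must also be independent: the
    minors of the coordinate matrix of v_1, ..., v_s are alternating multilinear
    functions of the v's, and are dual to those wedges ([ext_minor_wedge]). Hence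
    sigma can be written as the sum over I of (I-th minor) T_I. For s = c the only
    increasing family is the identity, so e_1 /\ ... /\ e_c is a basis of the top
    exterior power.

    As s + j.+1 and (s + j).+1 are not convertible, the identities between the
    components of sigma do not typecheck degree by degree. They are proved in the
    product of the K_n, where D and the T_i are endomorphisms and
    no degree appears; degrees come back by reading off one component.

    Both H_0 computations are direct: H_0(K) = M by exactness, and every class in
    H_0(E (x) K) is that of some 1 (x) a, whose image in R (x) M vanishes only if
    a is a boundary ([tot_aug_bij]). On such representatives sigma is a |-> a,
    whence the multiplication map ([induces_multiplicationI]). *)

(** * Increasing families of indices *)

Definition increasing m n (f : 'I_m -> 'I_n) : bool :=
  [forall k : 'I_m, forall l : 'I_m, (k < l)%N ==> (f k < f l)%N].

Lemma increasingP m n (f : 'I_m -> 'I_n) :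
  reflect {homo f : k l / (k < l)%N} (increasing f).
Proof.
apply: (iffP forallP) => [h k l kl | h k].
  by move: (forallP (h k) l); rewrite kl.
by apply/forallP => l; apply/implyP/h.
Qed.

Lemma increasing_inj m n (f : 'I_m -> 'I_n) :
  {homo f : k l / (k < l)%N} -> injective f.
Proof.
move=> fh k l fkl; apply: val_inj; case: (ltngtP k l) => // /fh.
  by rewrite fkl ltnn.
by rewrite fkl ltnn.
Qed.

Lemma increasing_comp m n p (f : 'I_n -> 'I_p) (h : 'I_m -> 'I_n) :
    {homo f : k l / (k < l)%N} -> {homo h : k l / (k < l)%N} ->
  {homo f \o h : k l / (k < l)%N}.
Proof. by move=> fh hh k l /hh /fh. Qed.

Lemma lift_increasing m (k : 'I_m.+1) : {homo lift k : i j / (i < j)%N}.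
Proof.
by move=> i j; rewrite /= !ltnNge leq_bump2.
Qed.

(** Both families list the same set of indices, and a set of numbers has only
    one increasing enumeration. *)
Lemma increasing_perm_eq m n (f h : 'I_m -> 'I_n) (p : 'S_m) :
    {homo f : k l / (k < l)%N} -> {homo h : k l / (k < l)%N} ->
  f =1 h \o p -> f =1 h.
Proof.
move=> fh hh fp.
have srt (u : 'I_m -> 'I_n) : {homo u : k l / (k < l)%N} ->
    sorted (fun x y : 'I_n => (x < y)%N) [seq u k | k <- enum 'I_m].
  move=> uh; rewrite sorted_map.
  apply: (sub_sorted (e := relpre (val : 'I_m -> nat) ltn)); first exact: uh.
  by rewrite -sorted_map val_enum_ord iota_ltn_sorted.
have E : [seq f k | k <- enum 'I_m] = [seq h k | k <- enum 'I_m].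
  apply: (irr_sorted_eq (leT := fun x y : 'I_n => (x < y)%N)).
  - by move=> y x z; apply: ltn_trans.
  - by move=> x; apply: ltnn.
  - exact: srt.
  - exact: srt.
  move=> x; apply/mapP/mapP => -[k _ ->].
    by exists (p k); rewrite ?mem_enum ?fp.
  by exists (p^-1%g k); rewrite ?mem_enum // fp /= permKV.
by move/eq_in_map: E => E k; apply: E; rewrite mem_enum.
Qed.

(** h lists the values of f in sorted order; injectivity of f makes it strictly
    increasing. *)
Lemma sort_family m n (f : 'I_m -> 'I_n) : injective f ->
  exists (h : 'I_m -> 'I_n) (p : 'S_m),
    {homo h : k l / (k < l)%N} /\ f =1 h \o p.
Proof.
move=> finj; pose le (x y : 'I_n) := (x <= y)%N.
pose t := [tuple f k | k < m]; pose st := [tuple of sort le t].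
have pst : perm_eq t st by rewrite perm_sym perm_sort.
have [p tp] := tuple_permP pst.
have tot_le : total le by move=> x y; apply: leq_total.
have tr_le : transitive le by move=> y x z; apply: leq_trans.
exists (tnth st), p; split; last first.
  move=> k /=; have : tnth t k = tnth [tuple tnth st (p i) | i < m] k.
    by congr tnth; apply: val_inj.
  by rewrite !tnth_mktuple.
have ut : uniq st.
  by rewrite -(perm_uniq pst) map_inj_uniq ?enum_uniq.
move=> k l kl; have x0 := tnth st k.
rewrite !(tnth_nth x0) ltn_neqAle; apply/andP; split.
  by rewrite -[_ != _]/(nth x0 st k != nth x0 st l) nth_uniq ?size_tuple ?ltn_eqF.
have srt : sorted le st by apply: sort_sorted.
by apply: (sorted_ltn_nth tr_le x0 srt); rewrite ?inE ?size_tuple ?ltn_ord.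
Qed.

(** * Generation of exterior powers by increasing wedges *)

Section Spanning.
Variables (S : comNzRingType) (V : lmodType S) (c : nat) (e : 'I_c -> V).
Hypothesis span_e : forall v, exists u : 'I_c -> S, v = \sum_i u i *: e i.

Lemma wedge_upd_sum s (v : 'I_s -> V) k (u : 'I_c -> S) :
  wedge (upd v k (\sum_i u i *: e i)) = \sum_i u i *: wedge (upd v k (e i)).
Proof.
have w0 : wedge (upd v k 0) = 0.
  apply: (addrI (wedge (upd v k 0))).
  by have := wedge_lin v k 1 0 0; rewrite scaler0 !addr0 scale1r.
elim: (index_enum 'I_c) => [|i r IH]; first by rewrite !big_nil w0.
by rewrite !big_cons wedge_lin IH.
Qed.

(** Multilinearity reduces to wedges of members of e, alternation kills the
    ones with a repetition and sorts the others. *)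
Lemma ext_eq_increasing s (P : lmodType S) (f h : {linear ext_power V s -> P}) :
    (forall i : 'I_s -> 'I_c, {homo i : k l / (k < l)%N} ->
       f (wedge (e \o i)) = h (wedge (e \o i))) ->
  forall z, f z = h z.
Proof.
move=> fh; apply: ext_ext.
have fhF (F : 'I_s -> 'I_c) : f (wedge (e \o F)) = h (wedge (e \o F)).
  have [Finj|] := boolP (injectiveb F).
    have [i [p [ih Fp]]] := sort_family (injectiveP _ Finj).
    have -> : e \o F = (e \o i) \o p by apply/funext => k /=; rewrite Fp.
    by rewrite wedge_perm !linearZ_LR /= fh.
  case/injectivePn => k [l lk Fkl].
  have lk' : k != l by rewrite eq_sym in lk *.
  by rewrite (wedge_alt lk') ?linear0 //= Fkl.
(* Induction on the number m of leading entries that need not be members of e: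
   the last of these is expanded. *)
suff H m : forall v : 'I_s -> V,
    (forall k : 'I_s, (m <= k)%N -> exists j, v k = e j) ->
    f (wedge v) = h (wedge v).
  by move=> v; apply: (H s) => k; rewrite leqNgt ltn_ord.
elim: m => [|m IH] v vE.
  have /fin_all_exists[F FE] : forall k, exists j, v k = e j by move=> k; apply: vE.
  by have -> : v = e \o F by apply/funext.
have [ms|sm] := ltnP m s; last first.
  by apply: IH => k mk; have := leq_trans sm mk; rewrite leqNgt ltn_ord.
have [u vu] := span_e (v (Ordinal ms)).
rewrite -(upd_id v (Ordinal ms)) vu wedge_upd_sum !linear_sum.
apply: eq_bigr => j _; rewrite !linearZ_LR /=; congr (_ *: _); apply: IH => k mk.
rewrite /upd; case: eqP => [_|/eqP km]; first by exists j.
by apply: vE; rewrite ltn_neqAle mk andbT eq_sym -(inj_eq val_inj) in km *.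
Qed.

End Spanning.

(** * Minors as coordinates on the exterior power *)

Section Minors.
Variables (S : comNzRingType) (V : lmodType S) (c : nat).
Variable co : {linear V -> 'rV[S]_c}.

(** Rows are the vectors v_k; the columns are those selected by i. *)
Definition minor s (i : 'I_s -> 'I_c) (v : 'I_s -> V) : S^o :=
  \det (\matrix_(k, l) co (v k) 0 (i l)).

Lemma minor_lin s (i : 'I_s -> 'I_c) : multilinear (minor i).
Proof.
move=> v k a x y; rewrite /minor.
rewrite -[RHS]/(a * _ + _) -[X in _ = _ + X]mul1r.
apply: (determinant_multilinear (i0 := k)).
- by apply/rowP => l; rewrite !mxE /upd eqxx linearP !mxE mul1r.
- by apply/matrixP => m l; rewrite !mxE /upd eq_sym (negPf (neq_lift _ _)).
- by apply/matrixP => m l; rewrite !mxE /upd eq_sym (negPf (neq_lift _ _)).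
Qed.

Lemma minor_alt s (i : 'I_s -> 'I_c) : alternating (minor i).
Proof.
move=> v k l kl vkl; apply: (determinant_alternate kl) => m.
by rewrite !mxE vkl.
Qed.

Definition ext_minor s (i : 'I_s -> 'I_c) : ext_power V s -> S^o :=
  elift (minor_lin i) (minor_alt i).

HB.instance Definition _ s (i : 'I_s -> 'I_c) := GRing.Linear.copy (ext_minor i)
  (elift (minor_lin i) (minor_alt i)).

Variable e : 'I_c -> V.
Hypothesis co_e : forall j, co (e j) = delta_mx 0 j.

(** A nonzero term of the determinant comes from a permutation p with h = i p,
    which forces h = i as both are increasing. *)
Lemma ext_minor_wedge s (i h : 'I_s -> 'I_c) :
    {homo i : k l / (k < l)%N} -> {homo h : k l / (k < l)%N} ->
  ext_minor i (wedge (e \o h)) = (finfun i == finfun h)%:R.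
Proof.
move=> ih hh; rewrite /ext_minor elift_wedge /minor.
case: eqP => [ihE|ihN].
  have {}ihE k : i k = h k by have /ffunP/(_ k) := ihE; rewrite !ffunE.
  rewrite -[RHS](det1 _ s); congr (\det _); apply/matrixP => k l.
  by rewrite !mxE /= co_e !mxE ihE eqxx eq_sym (inj_eq (increasing_inj hh)).
rewrite /determinant big1 // => p _.
have [/forallP hp|] := boolP [forall k, h k == i (p k)].
  case: ihN; apply/ffunP => k; rewrite !ffunE.
  by rewrite (increasing_perm_eq hh ih (fun l => eqP (hp l))).
rewrite negb_forall => /existsP [k hk].
by rewrite (bigD1 k) //= !mxE /= co_e !mxE eqxx eq_sym (negPf hk) mul0r mulr0.
Qed.

End Minors.

(** A spanning family of c vectors in S^c is a square matrix with a left
    inverse, and over a commutative ring this is a two-sided inverse. *)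
Lemma basis_coordinates (S : comNzRingType) c (e : 'I_c -> 'rV[S]_c) :
  is_basis e ->
  exists2 co : {linear 'rV[S]_c -> 'rV[S]_c},
    forall j, co (e j) = delta_mx 0 j &
    forall v, v = \sum_i co v 0 i *: e i.
Proof.
case=> sp _; pose B := \matrix_i e i.
have spB v : exists u : 'rV[S]_c, v = u *m B.
  have [s [a ->]] := sp v; elim: s => [|i s [u IH]].
    by exists 0; rewrite big_nil mul0mx.
  exists (a i *: delta_mx 0 i + u).
  by rewrite big_cons mulmxDl IH -scalemxAl -rowE rowK.
have /fin_all_exists[U UE] := fun i : 'I_c => spB (delta_mx 0 i).
pose A := \matrix_i U i.
have AB : A *m B = 1%:M.
  by apply/row_matrixP => i; rewrite row_mul rowK -UE row1.
have BA := mulmx1C AB.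
exists (mulmxr A) => [j|v] /=.
  by rewrite -[e j](rowK e) -row_mul BA row1.
rewrite -[LHS]mulmx1 -AB mulmxA mulmx_sum_row.
by apply: eq_bigr => i _; rewrite rowK.
Qed.

(** * Linear maps out of a tensor product *)

Lemma tens_scalel (S : comNzRingType) (M N : lmodType S) b (x : M) (y : N) :
  tens (b *: x) y = b *: tens x y.
Proof. by rewrite -[b *: x]addr0 tensPl tens0l addr0. Qed.

Lemma tens_scaler (S : comNzRingType) (M N : lmodType S) b (x : M) (y : N) :
  tens x (b *: y) = b *: tens x y.
Proof. by rewrite -[b *: y]addr0 tensPr tens0r addr0. Qed.

Lemma tens_suml (S : comNzRingType) (M N : lmodType S) n (b : 'I_n -> S)
    (x : 'I_n -> M) (y : N) :
  tens (\sum_k b k *: x k) y = \sum_k b k *: tens (x k) y.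
Proof.
elim: (index_enum 'I_n) => [|k r IH]; first by rewrite !big_nil tens0l.
by rewrite !big_cons tensPl IH.
Qed.

(** f and h are bare functions with linearity hypotheses because the maps compared
    below are sums of composites defined by cases on the degree. *)
Lemma tensor_eq_increasing (S : comNzRingType) (V : lmodType S) c (e : 'I_c -> V)
    (span_e : forall v, exists u : 'I_c -> S, v = \sum_i u i *: e i)
    s (N P : lmodType S) (f h : tensor (ext_power V s) N -> P) :
    linear f -> linear h ->
    (forall i : 'I_s -> 'I_c, {homo i : k l / (k < l)%N} ->
       forall a, f (tens (wedge (e \o i)) a) = h (tens (wedge (e \o i)) a)) ->
  f =1 h.
Proof.
move=> fl hl fh.
pose f' : {linear _ -> _} := HB.pack f (GRing.isLinear.Build S _ _ _ f fl).
pose h' : {linear _ -> _} := HB.pack h (GRing.isLinear.Build S _ _ _ h hl).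
apply: (tensor_ext (f := f') (h := h')) => x a.
have ql (q : {linear tensor (ext_power V s) N -> P}) :
    linear (fun z => q (tens z a)).
  by move=> b z w; rewrite tensPl linearP.
pose fa : {linear _ -> _} := HB.pack (fun z => f' (tens z a))
  (GRing.isLinear.Build S _ _ _ (fun z => f' (tens z a)) (ql f')).
pose ha : {linear _ -> _} := HB.pack (fun z => h' (tens z a))
  (GRing.isLinear.Build S _ _ _ (fun z => h' (tens z a)) (ql h')).
by apply: (ext_eq_increasing span_e (f := fa) (h := ha)) => i ih; apply: fh.
Qed.

(** * Homotopies on the total module of a complex *)

Section Total.
Variables (S : comNzRingType) (K : complex S).

Local Notation total := (dprod K).

(** The element of the product whose only nonzero component is a, in degree n. *)
Definition inj_deg n (a : K n) : total :=
  @dfwith _ (fun n => K n : Type) (fun=> 0) n a.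

Lemma inj_deg_in n (a : K n) : inj_deg a n = a.
Proof. exact: dfwith_in. Qed.

Lemma inj_deg_out n m (a : K n) : n != m -> inj_deg a m = 0.
Proof. exact: dfwith_out. Qed.

Lemma inj_deg_linear n : linear (@inj_deg n).
Proof.
move=> b x y; apply: functional_extensionality_dep => m.
rewrite dprod_scaleDE; have [->|nm] := eqVneq m n; first by rewrite !inj_deg_in.
by rewrite !inj_deg_out 1?eq_sym // scaler0 addr0.
Qed.

HB.instance Definition _ n := GRing.isLinear.Build S (K n) total *:%R
  (@inj_deg n) (@inj_deg_linear n).

(** The component of degree 0 of the product is mapped to K_(-1) = 0, hence is
    forgotten. *)
Definition tot_diff (x : total) : total := fun n => cdiff K n (x n.+1).

Lemma tot_diff_linear : linear tot_diff.
Proof.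
move=> b x y; apply: functional_extensionality_dep => m.
by rewrite dprod_scaleDE /tot_diff dprod_scaleDE linearP.
Qed.

HB.instance Definition _ := GRing.isLinear.Build S total total *:%R
  tot_diff tot_diff_linear.

Lemma tot_diff_inj0 (a : K 0) : tot_diff (inj_deg a) = 0.
Proof.
apply: functional_extensionality_dep => m.
by rewrite /tot_diff inj_deg_out // linear0.
Qed.

Lemma tot_diff_injS n (a : K n.+1) : tot_diff (inj_deg a) = inj_deg (cdiff K n a).
Proof.
apply: functional_extensionality_dep => m; rewrite /tot_diff.
have [->|nm] := eqVneq m n; first by rewrite !inj_deg_in.
by rewrite !inj_deg_out ?linear0 // eq_sym.
Qed.

Section Raise.
Variable t : forall n, {linear K n -> K n.+1}.

Definition tot_htpy (x : total) : total :=
  fun n => if n is m.+1 then t m (x m) else 0.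

Lemma tot_htpy_linear : linear tot_htpy.
Proof.
move=> b x y; apply: functional_extensionality_dep => -[|m].
  by rewrite dprod_scaleDE /= scaler0 addr0.
by rewrite dprod_scaleDE /= dprod_scaleDE linearP.
Qed.

HB.instance Definition _ := GRing.isLinear.Build S total total *:%R
  tot_htpy tot_htpy_linear.

Lemma tot_htpy_inj n (a : K n) : tot_htpy (inj_deg a) = inj_deg (t n a).
Proof.
apply: functional_extensionality_dep => -[|m] /=; first by rewrite inj_deg_out.
have [->|nm] := eqVneq m n; first by rewrite !inj_deg_in.
by rewrite !inj_deg_out ?linear0 // eq_sym.
Qed.

(** On the product the homotopy identity has one form in all degrees, including
    degree 0, where the component of the second term is zero. *)
Lemma tot_htpyP b x : homotopy_for b t ->
  tot_diff (tot_htpy x) = b *: x - tot_htpy (tot_diff x).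
Proof.
case=> t0 tS; apply/eqP; rewrite eq_sym subr_eq; apply/eqP.
apply: functional_extensionality_dep => -[|m].
  by rewrite -[LHS]t0 -[LHS]addr0.
exact/esym/tS.
Qed.

End Raise.

Variables (c : nat) (g : 'I_c -> S).
Variable tau : 'I_c -> forall n, {linear K n -> K n.+1}.

Lemma iter_tau_linear s j (i : 'I_s -> 'I_c) :
  linear (@iter_tau S K _ tau s j i).
Proof. by elim: s i => [|s IH] i b x y //=; rewrite IH linearP. Qed.

Fixpoint tot_iter s : ('I_s -> 'I_c) -> total -> total :=
  if s is s'.+1 then
    fun i x => tot_htpy (tau (i ord0)) (tot_iter (fun k => i (lift ord0 k)) x)
  else fun _ x => x.

Lemma tot_iter_linear s (i : 'I_s -> 'I_c) : linear (tot_iter i).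
Proof. by elim: s i => [|s IH] i b x y //=; rewrite IH linearP. Qed.

HB.instance Definition _ s (i : 'I_s -> 'I_c) := GRing.isLinear.Build S total
  total *:%R (tot_iter i) (tot_iter_linear i).

Lemma tot_iter_inj s j (i : 'I_s -> 'I_c) (a : K j) :
  tot_iter i (inj_deg a) = inj_deg (iter_tau tau i a).
Proof. by elim: s i => [|s IH] i //=; rewrite IH tot_htpy_inj. Qed.

Hypothesis htau : forall j, homotopy_for (g j) (tau j).

(** Moving the differential past each homotopy in turn picks up the scalar
    g_(i k) with the sign of the k homotopies already passed: these are the
    terms of the Koszul differential. *)
Lemma tot_diff_iter s (i : 'I_s.+1 -> 'I_c) x :
  tot_diff (tot_iter i x) =
    \sum_(k < s.+1) (-1) ^+ k *: (g (i k) *: tot_iter (i \o lift k) x)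
    + (-1) ^+ s.+1 *: tot_iter i (tot_diff x).
Proof.
elim: s i => [|s IH] i.
  by rewrite big_ord1 /= (tot_htpyP _ (htau _)) expr0 scale1r expr1 scaleN1r.
rewrite [tot_iter i x]/= -/(tot_iter _) (tot_htpyP _ (htau _)).
rewrite -/(@tot_iter s.+1 (fun k => i (lift ord0 k)) x) IH.
rewrite raddfD /= raddf_sum /= opprD addrA; congr (_ + _); last first.
  by rewrite linearZ_LR /= [in RHS]exprS mulN1r scaleNr.
rewrite [in RHS]big_ord_recl expr0 scale1r; congr (_ + _).
rewrite -sumrN; apply: eq_bigr => k _.
rewrite lift0 [in RHS]exprS mulN1r scaleNr; congr (- _).
rewrite 2!linearZ_LR /=; congr (_ *: (_ *: _)).
have -> : i (lift (lift ord0 k) ord0) = i ord0 by congr i; apply: val_inj.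
congr (tot_htpy _ (tot_iter _ _)); apply/funext => l /=; congr i.
by apply: val_inj; rewrite /= /bump /= !add1n ltnS addnS.
Qed.

End Total.

(** * The map of complexes *)

Section KoszulMap.
Variables (S : comNzRingType) (c : nat) (g : 'I_c -> S) (K : complex S).
Variable tau : 'I_c -> forall n, {linear K n -> K n.+1}.
Hypothesis htau : forall j, homotopy_for (g j) (tau j).
Variable e : 'I_c -> 'rV[S]_c.
Hypothesis span_e : forall v, exists u : 'I_c -> S, v = \sum_i u i *: e i.
Hypothesis de : forall i, lin_form g (e i) = g i.

Local Notation E := (koszul_seq g).
Local Notation total := (dprod K).

Variable sigma : forall s j, {linear tensor (E s) (K j) -> K (s + j)%N}.
Hypothesis sigmaP : sigma_spec e tau sigma.

Definition tot_sigma s j (z : tensor (E s) (K j)) : total := inj_deg (sigma s j z).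

Lemma tot_sigma_linear s j : linear (@tot_sigma s j).
Proof. by move=> b x y; rewrite /tot_sigma !linearP. Qed.

HB.instance Definition _ s j := GRing.isLinear.Build S (tensor (E s) (K j)) total
  *:%R (@tot_sigma s j) (@tot_sigma_linear s j).

(** The two halves of sigma composed with the differential of E (x) K, extended by
    zero where E_(s-1) or K_(j-1) is zero. *)
Definition sigma_dl s j : tensor (E s) (K j) -> total :=
  if s is s'.+1 then fun z => tot_sigma (tmap (cdiff E s') idfun z) else fun=> 0.

Definition sigma_dr s j : tensor (E s) (K j) -> total :=
  if j is j'.+1 then
    fun z => (-1) ^+ s *: tot_sigma (tmap idfun (cdiff K j') z)
  else fun=> 0.

Lemma sigma_dl_linear s j : linear (@sigma_dl s j).
Proof.
case: s => [|s] b x y /=; first by rewrite scaler0 addr0.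
by rewrite tmapP linearP.
Qed.

Lemma sigma_dr_linear s j : linear (@sigma_dr s j).
Proof.
case: j => [|j] b x y /=; first by rewrite scaler0 addr0.
by rewrite tmapP linearP scalerDr !scalerA mulrC.
Qed.

(** On the generators this is [tot_diff_iter], both sides being linear. *)
Lemma tot_diff_sigma s j (z : tensor (E s) (K j)) :
  tot_diff (tot_sigma z) = sigma_dl z + sigma_dr z.
Proof.
move: z; apply: (tensor_eq_increasing span_e).
- by move=> b x y; rewrite !linearP.
- by move=> b x y; rewrite sigma_dl_linear sigma_dr_linear scalerDr addrACA.
move=> i ih a; rewrite /tot_sigma sigmaP // -tot_iter_inj.
have drE : sigma_dr (tens (wedge (e \o i) : E s) a)
         = (-1) ^+ s *: tot_iter tau i (tot_diff (inj_deg a)).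
  case: j a => [|j] a /=.
    by rewrite tot_diff_inj0 linear0 scaler0.
  by rewrite tmap_tens /tot_sigma sigmaP // tot_diff_injS tot_iter_inj.
rewrite drE; case: s i ih {drE} => [|s] i ih.
  by rewrite /= add0r expr0 scale1r.
rewrite (tot_diff_iter htau); congr (_ + _).
rewrite /= tmap_tens.
have -> : cdiff E s (wedge (e \o i))
        = \sum_(k < s.+1) ((-1) ^+ k * g (i k)) *: wedge (e \o (i \o lift k)).
  rewrite [LHS]kos_d_wedge; apply: eq_bigr => k _.
  by rewrite scalerA /= de.
rewrite tens_suml linear_sum; apply: eq_bigr => k _.
rewrite [RHS]linearZ_LR /= -scalerA /tot_sigma.
rewrite sigmaP ?tot_iter_inj //; exact: increasing_comp (lift_increasing k).
Qed.

(** The index s alone determines the bidegree, so sums over bideg n become sums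
    over 'I_n.+1. *)
Definition bideg_at n (s : 'I_n.+1) : bideg n :=
  exist _ (val s, n - s)%N (introT eqP (subnKC (leq_ord s))).

(** Bidegrees with the same underlying pair of numbers are equal, but rewriting
    with this equality is blocked by the types that depend on the bidegree; mapping
    to a fixed type P removes the dependency. *)
Lemma tot_transport n (x : tot E K n) (P : Type)
    (F : forall s j, tensor (E s) (K j) -> P) (p q : bideg n) :
  val p = val q -> F _ _ (x p) = F _ _ (x q).
Proof. by move/val_inj->. Qed.

(** The sum of the components of sigma in total degree n, valued in the product so
    that its terms live in one type. *)
Definition total_map n (x : tot E K n) : total :=
  \sum_(s < n.+1) tot_sigma (x (bideg_at s)).

Lemma total_map_linear n : linear (@total_map n).
Proof.
move=> b x y; rewrite /total_map scaler_sumr -big_split /=.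
by apply: eq_bigr => s _; rewrite dprod_scaleDE linearP.
Qed.

(** Summing [tot_diff_sigma] over the bidegrees of total degree n + 1: the left
    halves are reindexed by s |-> s + 1 and the right ones keep s, the two
    extreme terms being zero. *)
Lemma total_map_diff n (x : tot E K n.+1) :
  total_map (tot_d x) = tot_diff (total_map x).
Proof.
rewrite /total_map linear_sum /=.
transitivity (\sum_(s < n.+1) (sigma_dl (x (bidegl (bideg_at s)))
                              + sigma_dr (x (bidegr (bideg_at s))))).
  by apply: eq_bigr => s _; rewrite /tot_d linearD linearZ_LR.
under [RHS]eq_bigr => s _ do rewrite tot_diff_sigma.
rewrite !big_split; congr (_ + _).
  rewrite [RHS]big_ord_recl [X in _ = X + _]/= add0r; apply: eq_bigr => s _.
  apply: (tot_transport x (@sigma_dl) (p := bidegl (bideg_at s))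
    (q := bideg_at (lift ord0 s))).
  by rewrite -[RHS]/((bump 0 s), (n.+1 - bump 0 s))%N /bump add1n subSS.
rewrite [RHS]big_ord_recr.
have -> : sigma_dr (x (bideg_at ord_max)) = 0.
  (* s = n + 1 leaves j = 0, where sigma_dr is zero by definition. *)
  pose p : bideg n.+1 := exist _ (n.+1, 0)%N (introT eqP (addn0 n.+1)).
  rewrite (tot_transport x (@sigma_dr) (q := p)) //=.
  by rewrite subnn.
rewrite [RHS]addr0; apply: eq_bigr => s _.
apply: (tot_transport x (@sigma_dr) (p := bidegr (bideg_at s))
  (q := bideg_at (widen_ord (leqnSn n.+1) s))).
by rewrite /= subSn // leq_ord.
Qed.

(** Every term of [total_map] lies in degree s + (n - s) = n, so nothing is lost by
    keeping only that component. *)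
Definition koszul_map n (x : tot E K n) : K n := total_map x n.

Lemma koszul_map_linear n : linear (@koszul_map n).
Proof. by move=> b x y; rewrite /koszul_map total_map_linear. Qed.

HB.instance Definition _ n := GRing.isLinear.Build S (tot E K n) (K n) *:%R
  (@koszul_map n) (@koszul_map_linear n).

Lemma koszul_mapC n (x : tensor_complex E K n.+1) :
  koszul_map (cdiff (tensor_complex E K) n x) = cdiff K n (koszul_map x).
Proof. by rewrite /koszul_map [LHS](congr1 (@^~ n) (total_map_diff x)). Qed.

Definition koszul_chain_map : chain_map (tensor_complex E K) K :=
  @ChainMap S (tensor_complex E K) K (fun n => koszul_map (n := n)) koszul_mapC.

Lemma koszul_chain_map_in s j (z : tensor (E s) (K j)) :
  koszul_chain_map (s + j)%N (tot_in z) = sigma s j z.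
Proof.
rewrite /= /koszul_map /total_map.
have sj : (s < (s + j).+1)%N by rewrite ltnS leq_addr.
have inE : tot_in z (bideg_of s j) = z by apply: dfwith_in.
rewrite (bigD1 (Ordinal sj)) //= big1 => [|i iNs].
  rewrite addr0 (tot_transport (tot_in z) (@tot_sigma)
    (p := bideg_at (Ordinal sj)) (q := bideg_of s j)) /= ?addKn //.
  by rewrite inE; apply: inj_deg_in.
have -> : tot_in z (bideg_at i) = 0.
  apply: dfwith_out.
  by apply: contra_neq iNs => /(congr1 val) [si _]; apply: val_inj.
by rewrite linear0.
Qed.

End KoszulMap.

(** * Zeroth homology *)

Lemma bijective_linear (S : comNzRingType) (U V : lmodType S) (f : {linear U -> V}) :
    (forall x, f x = 0 -> x = 0) -> (forall y, exists x, f x = y) ->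
  bijective f.
Proof.
move=> f0 /choice[h hK]; exists h => // x.
by apply/eqP; rewrite -subr_eq0; apply/eqP/f0; rewrite raddfB /= hK subrr.
Qed.

Lemma ext0_scale (S : comNzRingType) (V : lmodType S) (v : 'I_0 -> V) x :
  x = ext0 x *: wedge v.
Proof.
have hl : linear (fun z : ext_power V 0 => (ext0 z : S) *: wedge v).
  by move=> b z w; rewrite linearP scalerDl -scalerA.
pose h : {linear ext_power V 0 -> ext_power V 0} :=
  HB.pack (fun z => (ext0 z : S) *: wedge v) (GRing.isLinear.Build S _ _ _ _ hl).
apply: (ext_ext (f := idfun) (h := h)) => w /=.
by rewrite ext0_wedge scale1r; congr wedge; apply/funext => -[].
Qed.

(** When R is a quotient of S, tens r m = tens 1 (r m), so multiplication is
    inverse to m |-> tens 1 m. *)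
Lemma tens1_mul_map (S R : comNzRingType) (pi : {rmorphism S -> R})
    (pi_surj : forall r, exists a, pi a = r) (M : lmodType R)
    (z : tensor (restrict pi R^o) (restrict pi M)) :
  z = tens (1 : restrict pi R^o) (mul_map pi M z).
Proof.
have hl : linear (fun z : tensor (restrict pi R^o) (restrict pi M) =>
    tens (1 : restrict pi R^o) (mul_map pi M z)).
  by move=> b x y; rewrite linearP tensPr.
pose h : {linear tensor (restrict pi R^o) (restrict pi M) -> _} :=
  HB.pack (fun z => tens (1 : restrict pi R^o) (mul_map pi M z))
    (GRing.isLinear.Build S _ _ _ _ hl).
apply: (tensor_ext (f := idfun) (h := h)) => r m /=.
have [a <-] := pi_surj r; rewrite mul_map_tens.
rewrite -[pi a *: m]/(a *: (m : restrict pi M)) tens_scaler -tens_scalel.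
by congr tens; rewrite restrict_scaleE -[RHS]/(pi a * 1) mulr1.
Qed.

Section ZerothHomology.
Variables (S R : comNzRingType) (pi : {rmorphism S -> R}).
Hypothesis pi_surj : forall r, exists a, pi a = r.
Variables (c : nat) (g : 'I_c -> S).
Hypothesis pi_g : forall i, pi (g i) = 0.
Variables (M : lmodType R) (K : complex S) (eps : {linear K 0%N -> restrict pi M}).
Hypothesis eps_exact : forall x, eps x = 0 <-> exists y, x = cdiff K 0 y.
Hypothesis eps_surj : forall m, exists x, eps x = m.

Local Notation E := (koszul_seq g).
Local Notation EK := (tensor_complex E K).
Local Notation RM := (tensor (restrict pi R^o) (restrict pi M)).

Definition wedge0 : E 0%N := wedge (fun=> 0).

(** [tot_in] at bidegree (0, 0), with the sum 0 + 0 computed. *)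
Definition tot_in0 (z : tensor (E 0%N) (K 0%N)) : EK 0%N :=
  tot_in (C := E) (D := K) z.

Lemma tot_in0_linear : linear tot_in0.
Proof.
move=> b x y; apply: functional_extensionality_dep => p.
rewrite dprod_scaleDE /tot_in0 /tot_in.
have [->|pN] := eqVneq p (bideg_of 0 0); first by rewrite !dfwith_in.
by rewrite !dfwith_out 1?eq_sym //; apply/esym/(etrans (addr0 _))/scaler0.
Qed.

HB.instance Definition _ := GRing.isLinear.Build S (tensor (E 0%N) (K 0%N))
  (EK 0%N) *:%R tot_in0 tot_in0_linear.

Lemma tot_in0_at x : tot_in0 x (bideg_of 0 0) = x.
Proof. exact: dfwith_in. Qed.

(** E_0 is free on the empty wedge, so E_0 (x) K_0 is a copy of K_0, and (0, 0) is
    the only bidegree of total degree 0. *)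
Lemma tot0E (x : EK 0%N) : exists a, x = tot_in0 (tens wedge0 a).
Proof.
have fl (a : K 0%N) : linear (fun w : E 0%N => (ext0 w : S) *: a).
  by move=> b w w'; rewrite linearP scalerDl -scalerA.
have fr (w : E 0%N) : linear (fun a : K 0%N => (ext0 w : S) *: a).
  by move=> b a a'; rewrite scalerDr !scalerA mulrC.
have hl : linear (fun z => tens wedge0 (tlift fl fr z)).
  by move=> b z w; rewrite linearP tensPr.
pose h : {linear tensor (E 0%N) (K 0%N) -> tensor (E 0%N) (K 0%N)} :=
  HB.pack (fun z => tens wedge0 (tlift fl fr z))
    (GRing.isLinear.Build S _ _ _ _ hl).
have zE (z : tensor (E 0%N) (K 0%N)) : z = h z.
  apply: (tensor_ext (f := idfun) (h := h)) => w a /=.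
  by rewrite tlift_tens tens_scaler -tens_scalel -ext0_scale.
exists (tlift fl fr (x (bideg_of 0 0))).
apply: functional_extensionality_dep => p.
have -> : p = bideg_of 0 0 by apply: val_inj; case: p => -[[|s] [|j]] /=.
by rewrite tot_in0_at [LHS]zE.
Qed.

(** The boundary of 1 (x) b is 1 (x) d b, as b sits beside the bottom degree of the
    Koszul complex. *)
Lemma tot_in0_boundary (b : K 1%N) :
  tot_in0 (tens wedge0 (cdiff K 0 b))
  = tot_d (tot_in (C := E) (D := K) (s := 0) (j := 1) (tens wedge0 b)).
Proof.
apply: functional_extensionality_dep => p.
have -> : p = bideg_of 0 0 by apply: val_inj; case: p => -[[|s] [|j]] /=.
rewrite tot_in0_at /tot_d.
have yr : tot_in (tens wedge0 b) (bidegr (bideg_of 0 0)) = tens wedge0 b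
    :> tensor (E 0%N) (K 1%N).
  have yI := @tot_irr S E K 1 (tot_in (s := 0) (j := 1) (tens wedge0 b)) 0 1
    (proj2_sig (bidegr (bideg_of 0 0))) (eqxx 1%N).
  by apply: (etrans yI); apply: dfwith_in.
rewrite [X in _ + _ *: tmap _ _ X]yr.
have -> : tot_in (tens wedge0 b) (bidegl (bideg_of 0 0)) = 0 by apply: dfwith_out.
by rewrite linear0 add0r expr0 scale1r tmap_tens.
Qed.

(** The augmentation of the Koszul complex onto R. *)
Definition aug (w : E 0%N) : restrict pi R^o := pi (ext0 w).

Lemma aug_linear : linear aug.
Proof.
move=> b w w'; rewrite /aug linearP rmorphD; congr (_ + _).
exact: rmorphM.
Qed.

HB.instance Definition _ := GRing.isLinear.Build S (E 0%N) (restrict pi R^o)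
  *:%R aug aug_linear.

(** The image of the first Koszul differential is the ideal (g). *)
Lemma aug_d (w : E 1%N) : aug (cdiff E 0 w) = 0.
Proof.
pose f : {linear E 1%N -> restrict pi R^o} := aug \o cdiff E 0.
apply: (ext_ext (f := f) (h := \0)) => v /=.
rewrite [cdiff E 0 _]kos_d_wedge big_ord1 expr0 scale1r linearZ_LR /=.
rewrite restrict_scaleE; have -> : pi (lin_form g (v ord0)) = 0.
  rewrite /lin_form rmorph_sum big1 // => i _.
  by rewrite [LHS]rmorphM pi_g mulr0.
by rewrite scale0r.
Qed.

Definition tot_aug (x : EK 0%N) : RM := tmap aug eps (x (bideg_of 0 0)).

Lemma tot_aug_linear : linear tot_aug.
Proof. by move=> b x y; rewrite /tot_aug dprod_scaleDE linearP. Qed.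

HB.instance Definition _ := GRing.isLinear.Build S (EK 0%N) RM *:%R
  tot_aug tot_aug_linear.

Lemma tot_aug_kills x :
  x \in submod_mem (range (cdiff EK 0)) -> tot_aug x = 0.
Proof.
move=> /asboolP [y ->]; rewrite /tot_aug /= /tot_d linearD linearZ_LR /=.
rewrite !tmap_comp tmap0l; last exact: aug_d.
rewrite tmap0r ?scaler0 ?addr0 // => a /=.
by apply/eps_exact; exists a.
Qed.

Lemma eps_kills x : x \in submod_mem (range (cdiff K 0)) -> eps x = 0.
Proof. by move=> /asboolP [y ->]; apply/eps_exact; exists y. Qed.

(** Every class of H_0(E (x) K) is represented by some 1 (x) a, which is sent to
    1 (x) eps a; if this vanishes then a is a boundary d b, and 1 (x) a is the
    boundary of 1 (x) b. *)
Lemma tot_aug_bij : bijective (qlift tot_aug_kills).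
Proof.
have augE a : tot_aug (tot_in0 (tens wedge0 a)) = tens (1 : restrict pi R^o) (eps a).
  by rewrite /tot_aug tot_in0_at tmap_tens /= /aug ext0_wedge rmorph1.
have mulE (m : restrict pi M) : mul_map pi M (tens (1 : restrict pi R^o) m) = m.
  by rewrite mul_map_tens scale1r.
apply: bijective_linear => [x|z].
  rewrite -[x]qreprK; have [a ->] := tot0E (qrepr x).
  rewrite [LHS]qliftE [LHS]augE => /(congr1 (mul_map pi M)).
  rewrite mulE linear0 => /eps_exact[b ->].
  apply: qclass_eq0; apply/asboolP.
  exists (tot_in (C := E) (D := K) (s := 0) (j := 1) (tens wedge0 b)).
  exact: tot_in0_boundary.
(* z = 1 (x) m, and m lifts to K_0. *)
have [a aE] := eps_surj (mul_map pi M z).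
exists (qclass _ (tot_in0 (tens wedge0 a))).
by rewrite [LHS]qliftE [LHS]augE aE -tens1_mul_map.
Qed.

Lemma eps_bij : bijective (qlift eps_kills).
Proof.
apply: bijective_linear => [x|m].
  rewrite -[x]qreprK [LHS]qliftE => /eps_exact[y yE].
  by apply: qclass_eq0; apply/asboolP; exists y.
by have [x xE] := eps_surj m; exists (qclass _ x); rewrite [LHS]qliftE.
Qed.

(** Any chain map which is the identification S (x) K_0 = K_0 in degree 0 induces
    multiplication, as the classes of the 1 (x) a exhaust H_0. *)
Lemma induces_multiplicationI (Sigma : chain_map EK K) :
    (forall x a, Sigma 0%N (tot_in0 (tens x a)) = (ext0 x : S) *: a) ->
  induces_multiplication eps Sigma.
Proof.
move=> Sigma0.
exists (qlift tot_aug_kills), (qlift eps_kills); split.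
- by split; [apply: tot_aug_bij | apply: eps_bij].
- move=> x a; rewrite [LHS]qliftE -[tot_in _]/(tot_in0 (tens x a)).
  by rewrite /= /tot_aug tot_in0_at tmap_tens.
- by move=> a; rewrite [LHS]qliftE.
move=> z; rewrite -[z]qreprK; have [a ->] := tot0E (qrepr z).
rewrite -/(hclass0 _) homology0_map_class Sigma0 ext0_wedge scale1r.
rewrite [LHS]qliftE [X in mul_map _ _ X]qliftE /= /tot_aug tot_in0_at tmap_tens.
by rewrite mul_map_tens /= /aug ext0_wedge rmorph1 scale1r.
Qed.

End ZerothHomology.

(** * Existence and uniqueness of sigma *)

Section Sigma.
Variables (S : comNzRingType) (c : nat) (g : 'I_c -> S) (K : complex S).
Variable tau : 'I_c -> forall n, {linear K n -> K n.+1}.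
Variable e : 'I_c -> 'rV[S]_c.
Variable co : {linear 'rV[S]_c -> 'rV[S]_c}.
Hypothesis co_e : forall j, co (e j) = delta_mx 0 j.
Hypothesis span_e : forall v, exists u : 'I_c -> S, v = \sum_i u i *: e i.

Local Notation E := (koszul_seq g).

Definition sigma_form s j (x : E s) (a : K j) : K (s + j)%N :=
  \sum_(i : {ffun 'I_s -> 'I_c} | increasing i)
    (ext_minor co i x : S) *: iter_tau tau i a.

Lemma sigma_form_linl s j (a : K j) : linear (fun x : E s => sigma_form x a).
Proof.
move=> b x y; rewrite /sigma_form scaler_sumr -big_split /=.
by apply: eq_bigr => i _; rewrite linearP scalerDl -scalerA.
Qed.

Lemma sigma_form_linr s j (x : E s) : linear (@sigma_form s j x).
Proof.
move=> b a a'; rewrite /sigma_form scaler_sumr -big_split /=.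
apply: eq_bigr => i _; rewrite iter_tau_linear scalerDr !scalerA.
by rewrite [b * _]mulrC.
Qed.

Definition koszul_sigma s j : {linear tensor (E s) (K j) -> K (s + j)%N} :=
  tlift (@sigma_form_linl s j) (@sigma_form_linr s j).

Lemma koszul_sigmaP : sigma_spec e tau koszul_sigma.
Proof.
move=> s j h hh a; rewrite [LHS]tlift_tens /sigma_form.
have hE : finfun h = h :> ('I_s -> 'I_c) by apply/funext => k; rewrite ffunE.
rewrite (bigD1 (finfun h)) /=; last by rewrite hE; apply/increasingP.
rewrite hE (ext_minor_wedge co_e hh hh) eqxx scale1r.
rewrite big1 ?addr0 // => i /andP [/increasingP ii iNh].
by rewrite (ext_minor_wedge co_e ii hh) ffunK (negPf iNh) scale0r.
Qed.

Lemma koszul_sigma_uniq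
    (sigma sigma' : forall s j, {linear tensor (E s) (K j) -> K (s + j)%N}) :
    sigma_spec e tau sigma -> sigma_spec e tau sigma' ->
  forall s j z, sigma' s j z = sigma s j z.
Proof.
move=> sP sP' s j; apply: (tensor_eq_increasing span_e).
- exact: linearP.
- exact: linearP.
- by move=> i ih a; rewrite sP // sP'.
Qed.

(** The identity is the only increasing family of c indices below c. *)
Lemma ext_top (x : ext_power 'rV[S]_c c) :
  x = (ext_minor co (fun k : 'I_c => k) x : S) *: wedge e.
Proof.
pose id_c := fun k : 'I_c => k; have idh : {homo id_c : k l / (k < l)%N} by [].
have hl : linear (fun x => (ext_minor co id_c x : S) *: wedge e).
  by move=> b y z; rewrite linearP scalerDl -scalerA.
pose h : {linear ext_power 'rV[S]_c c -> ext_power 'rV[S]_c c} :=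
  HB.pack (fun x => (ext_minor co id_c x : S) *: wedge e)
    (GRing.isLinear.Build S _ _ _ _ hl).
apply: (ext_eq_increasing span_e (f := idfun) (h := h)) => i ih /=.
have -> : i = id_c.
  apply/funext; apply: (increasing_perm_eq ih idh (p := perm (increasing_inj ih))).
  by move=> k; rewrite /= permE.
by rewrite (ext_minor_wedge co_e idh idh) eqxx scale1r.
Qed.

(** The inverse multiplies a by the coordinate on e_1 /\ ... /\ e_c. *)
Lemma tens_top_bij i :
  bijective (fun a : K i => tens (wedge e : E c) a).
Proof.
pose m (x : E c) : S := ext_minor co (fun k : 'I_c => k) x.
have fl (a : K i) : linear (fun x => m x *: a).
  by move=> b x y; rewrite /m linearP scalerDl -scalerA.
have fr (x : E c) : linear (fun a : K i => m x *: a).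
  by move=> b a a'; rewrite scalerDr !scalerA mulrC.
have m1 : m (wedge e) = 1.
  have idh : {homo (fun k : 'I_c => k) : k l / (k < l)%N} by [].
  by rewrite /m -[e]/(e \o fun k => k) (ext_minor_wedge co_e idh idh) eqxx.
exists (tlift fl fr) => [a|z]; first by rewrite tlift_tens m1 scale1r.
have hl : linear (fun z => tens (wedge e : E c) (tlift fl fr z)).
  by move=> b x y; rewrite linearP tensPr.
pose h : {linear tensor (E c) (K i) -> tensor (E c) (K i)} :=
  HB.pack (fun z => tens (wedge e : E c) (tlift fl fr z))
    (GRing.isLinear.Build S _ _ _ _ hl).
apply/esym/(tensor_ext (f := idfun) (h := h)) => x a /=.
by rewrite tlift_tens tens_scaler -tens_scalel /m -ext_top.
Qed.

End Sigma.

(** * The action of the Koszul complex on the resolution *)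

Theorem proposition1p4
    (S : comNzRingType) (noethS : noetherian S)
    (c : nat) (g : 'I_c -> S) (regg : regular_sequence g)
    (M : lmodType (seq_quotient regg))
    (K : complex S) (eps : {linear K 0%N -> restrict (seq_proj regg) M})
    (resK : free_resolution eps)
    (tau : 'I_c -> forall n, {linear K n -> K n.+1})
    (htau : forall j, homotopy_for (g j) (tau j))
    (e : 'I_c -> 'rV[S]_c) (basis_e : is_basis e)
    (de : forall i, lin_form g (e i) = g i) :
  [/\ exists sigma : forall s j,
        {linear tensor (koszul_seq g s) (K j) -> K (s + j)%N},
        sigma_spec e tau sigma /\
        (forall sigma', sigma_spec e tau sigma' ->
           forall s j z, sigma' s j z = sigma s j z),
      forall sigma : forall s j,
        {linear tensor (koszul_seq g s) (K j) -> K (s + j)%N},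
        sigma_spec e tau sigma ->
        exists Sigma : chain_map (tensor_complex (koszul_seq g) K) K,
          (forall s j (z : tensor (koszul_seq g s) (K j)),
             Sigma (s + j)%N (tot_in z) = sigma s j z) /\
          induces_multiplication eps Sigma
    & exists Sigma : chain_map (tensor_complex (koszul_seq g) K) K,
        induces_multiplication eps Sigma /\
        forall i : nat,
          bijective (fun a : K i =>
            tens (wedge e : koszul_seq g c) a) /\
          forall a : K i,
            Sigma (c + i)%N (tot_in (tens (wedge e : koszul_seq g c) a))
            = iter_tau tau (fun k : 'I_c => k) a].
Proof.
have [co co_e coE] := basis_coordinates basis_e.
have span_e v : exists u : 'I_c -> S, v = \sum_i u i *: e i.
  by exists (fun i => co v 0 i).
have [_ _ exK surK] := resK.
have pi_surj r : exists a, seq_proj regg a = r.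
  by exists (generic_quotient.repr r); apply: reprK.
have pi_g i : seq_proj regg (g i) = 0.
  rewrite -[RHS](rmorph0 (seq_proj regg)).
  apply/eqP; rewrite -Quotient.idealrBE subr0; apply/asboolP.
  exists (fun k => (k == i)%:R); rewrite (bigD1 i) //= eqxx mul1r.
  by rewrite big1 ?addr0 // => k /negPf ->; rewrite mul0r.
have main sigma : sigma_spec e tau sigma ->
    exists Sigma : chain_map (tensor_complex (koszul_seq g) K) K,
      (forall s j (z : tensor (koszul_seq g s) (K j)),
         Sigma (s + j)%N (tot_in z) = sigma s j z) /\
      induces_multiplication eps Sigma.
  move=> sP; exists (koszul_chain_map htau span_e de sP).
  have inE := koszul_chain_map_in htau span_e de sP.
  split=> //; apply: (induces_multiplicationI pi_surj pi_g exK surK) => x a.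
  rewrite [LHS](inE 0%N 0%N) [in LHS](ext0_scale (e \o ffun0 (card_ord 0)) x).
  by rewrite tens_scalel linearZ_LR sP // => -[].
split; [|exact: main|].
  exists (koszul_sigma g tau co); split; first exact: koszul_sigmaP.
  by move=> sigma' sP'; apply: (koszul_sigma_uniq span_e (koszul_sigmaP _ _ co_e)).
have sP := koszul_sigmaP g tau co_e.
have [Sigma [inE mulSigma]] := main _ sP.
exists Sigma; split=> // i; split; first exact: (tens_top_bij g K co_e span_e).
by move=> a; rewrite inE (sP c i (fun k => k)).
Qed.
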